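(* A group $K$ is isomorphic to $G/Z$ for some minimal setup $(G,Z,\delta)$ if and only if $|K|=64$, $|K'|=8$ and $K'=Z(K)$. Moreover, every such group $K$ is isomorphic to $G/Z$ for some minimal setup $(G,Z,\delta)$ belonging to scenario (i) as described in the context.
   Context: Conventions: $x^y=y^{-1}xy$, $[x,y]=x^{-1}y^{-1}xy$; $G'$ is the derived subgroup, $Z(G)$ the center, $\mathrm{cl}(G)$ the nilpotency class of a group $G$. A (new) setup $(G,Z,\delta)$ consists of a group $G$, a subgroup $Z\le Z(G)$ and a mapping $\delta:G/Z\times G/Z\to Z$ (written $\delta(x,y)$ for $\delta(xZ,yZ)$, and also regarded as a mapping $G\times G\to Z$) such that: $\delta(x,x)=1$ for every $x\in G$; $\delta(x,y)=\delta(y,x)^{-1}$ for every $x,y\in G$; $\delta(xy,z)=\delta(x,z)\delta(y,z)$ whenever $x,y,z\in G$ and $\{x,y,z\}\cap G'\neq\emptyset$; $z^{yx}\delta([z,y],x)=z^{xy}\delta([z,x],y)$ for every $x,y,z\in G$. $\mathrm{Rad}_1\delta=\{t\in G: \delta(tx,y)=\delta(xt,y)=\delta(x,ty)=\delta(x,yt)=\delta(x,y)\text{ for all }x,y\in G\}$, and $\mathrm{Rad}\,\delta$ is the largest normal subgroup of $G$ contained in $\mathrm{Rad}_1\delta$. $\mathrm{Mul}\,\delta$ is the set (a subgroup) of all $t\in G$ such that for all $x,y\in G$: $\delta(tx,y)=\delta(t,y)\delta(x,y)=\delta(xt,y)$, $\delta(x,ty)=\delta(x,t)\delta(x,y)=\delta(x,yt)$,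 $\delta(xy,t)=\delta(x,t)\delta(y,t)$, $\delta(t,xy)=\delta(t,x)\delta(t,y)$. Mappings $f,g:G^3\to Z$ are defined by $f(x,y,z)=\delta([x,y],z)$ and $g(x,y,z)=f(x,y,z)f(y,z,x)f(z,x,y)$. They are homomorphisms in each argument, and $\mathrm{Rad}\,f=\{t\in G:f(t,x,y)=f(x,t,y)=f(x,y,t)=1\text{ for all }x,y\in G\}$. A setup is nontrivial if $g$ is not identically $1$. A minimal setup is a nontrivial setup with $|G|$ as small as possible among all nontrivial setups. (This smallest order is $128$, and $|Z|=2$ in every minimal setup.) Scenario (i): a minimal setup belongs to scenario (i) if, with $\overline{G}=G/\mathrm{Rad}\,\delta$, it satisfies $\mathrm{cl}(G)=2$, $G'<\mathrm{Mul}\,\delta=Z(G)$ (proper inclusion), $Z(\overline{G})=\mathrm{Rad}\,f/\mathrm{Rad}\,\delta=\overline{G}\,'$, $|\mathrm{Mul}\,\delta/\mathrm{Rad}\,\delta|=8$, $\mathrm{Rad}\,\delta=Z$ and $f=g$. *)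

(* Defs.v *)
From HB Require Import structures.
From mathcomp Require Import all_boot all_order all_fingroup all_solvable.
Set Implicit Arguments. Unset Strict Implicit. Unset Printing Implicit Defensive.
Import GroupScope.

(* MathComp's conventions are the intended ones: x ^ y = y^-1 * (x * y) and   *)
(* [~ x, y] = x^-1 * y^-1 * x * y.                                            *)

Section Setup.
Variables (gT : finGroupType) (G Z : {group gT}).

(* The values of delta matter only on G / Z; is_setup requires them to lie in *)
(* Z there. As Z <= Z(G), coset Z x is the coset xZ for every x in G.         *)
Variable delta : coset_of Z -> coset_of Z -> gT.

Definition delta_on (x y : gT) : gT := delta (coset Z x) (coset Z y).
Local Notation d := delta_on.

Record is_setup : Prop := IsSetup {
  setup_central : Z \subset 'Z(G);
  setup_codomain : {in G / Z &, forall u v, delta u v \in Z};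
  setup_diag : {in G, forall x, d x x = 1};
  setup_skew : {in G &, forall x y, d x y = (d y x)^-1};
  setup_mul : {in G & &, forall x y z,
    [|| x \in G^`(1), y \in G^`(1) | z \in G^`(1)] ->
    d (x * y) z = d x z * d y z};
  setup_conj : {in G & &, forall x y z,
    z ^ (y * x) * d [~ z, y] x = z ^ (x * y) * d [~ z, x] y}
}.

Definition Rad1 : {set gT} :=
  [set t in G | [forall x in G, forall y in G,
    [&& d (t * x) y == d x y, d (x * t) y == d x y,
        d x (t * y) == d x y & d x (y * t) == d x y]]].

Fact Rad1_group_set : group_set Rad1.
Proof.
have Rad1P t : reflect
    (t \in G /\ {in G &, forall x y,
      [/\ d (t * x) y = d x y, d (x * t) y = d x y,
          d x (t * y) = d x y & d x (y * t) = d x y]})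
    (t \in Rad1).
  rewrite inE; apply: (iffP andP) => [[Gt /forall_inP tP]|[Gt tP]]; split=> //.
    by move=> x y /tP/forall_inP tPx /tPx/and4P[/eqP-> /eqP-> /eqP-> /eqP->].
  apply/forall_inP=> x Gx; apply/forall_inP=> y Gy.
  by have [-> -> -> ->] := tP x y Gx Gy; rewrite !eqxx.
apply/group_setP; split=> [|s t /Rad1P[Gs sP] /Rad1P[Gt tP]].
  by apply/Rad1P; split=> [|x y _ _]; rewrite ?group1 // !mul1g !mulg1.
apply/Rad1P; split=> [|x y Gx Gy]; first exact: groupM.
have [tx1 tx2 ty1 ty2] := tP x y Gx Gy.
have [sx1 sx2 sy1 sy2] := sP x y Gx Gy.
rewrite -!(mulgA s) !(mulgA _ s t).
have [-> _ _ _] := sP _ y (groupM Gt Gx) Gy.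
have [_ -> _ _] := tP _ y (groupM Gx Gs) Gy.
have [_ _ -> _] := sP x _ Gx (groupM Gt Gy).
by have [_ _ _ ->] := tP x _ Gx (groupM Gy Gs).
Qed.

Canonical Rad1_group := Group Rad1_group_set.

Definition Rad : {set gT} := gcore Rad1 G.

Canonical Rad_group := Eval hnf in [group of Rad].

Fact Rad_normal : Rad <| G.
Proof. by apply: gcore_normal; apply/subsetP=> t; rewrite inE => /andP[]. Qed.

Fact Rad_sub_Rad1 : Rad \subset Rad1.
Proof. exact: gcore_sub. Qed.

Fact Rad_max (N : {group gT}) : N <| G -> N \subset Rad1 -> N \subset Rad.
Proof. by move=> /andP[_ nNG] sNR; apply: gcore_max. Qed.

Definition Mul : {set gT} :=
  [set t in G | [forall x in G, forall y in G,
    [&& d (t * x) y == d t y * d x y, d (x * t) y == d t y * d x y,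
        d x (t * y) == d x t * d x y, d x (y * t) == d x t * d x y,
        d (x * y) t == d x t * d y t & d t (x * y) == d t x * d t y]]].

Definition f (x y z : gT) : gT := d [~ x, y] z.

Definition g (x y z : gT) : gT := f x y z * f y z x * f z x y.

Definition Rad_f : {set gT} :=
  [set t in G | [forall x in G, forall y in G,
    [&& f t x y == 1, f x t y == 1 & f x y t == 1]]].

Definition nontrivial_setup : Prop :=
  is_setup /\ ~ {in G & &, forall x y z, g x y z = 1}.

Record scenario_i_conditions : Prop := ScenarioI {
  scenario_i_class : nil_class G = 2;
  scenario_i_derived : G^`(1) \proper Mul;
  scenario_i_Mul : Mul = 'Z(G);
  scenario_i_center : 'Z(G / Rad) = Rad_f / Rad;
  scenario_i_Rad_f : Rad_f / Rad = (G / Rad)^`(1);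
  scenario_i_index : #|Mul / Rad| = 8;
  scenario_i_Rad : Rad = Z;
  scenario_i_f_eq_g : {in G & &, forall x y z, f x y z = g x y z}
}.

End Setup.

Definition minimal_setup (gT : finGroupType) (G Z : {group gT})
    (delta : coset_of Z -> coset_of Z -> gT) : Prop :=
  nontrivial_setup G delta /\
  forall (hT : finGroupType) (H W : {group hT})
    (eps : coset_of W -> coset_of W -> hT),
  nontrivial_setup H eps -> #|G| <= #|H|.

Definition scenario_i (gT : finGroupType) (G Z : {group gT})
    (delta : coset_of Z -> coset_of Z -> gT) : Prop :=
  minimal_setup G delta /\ scenario_i_conditions G delta.

(* Main.v *)
Require Import Defs.
From HB Require Import structures.
From mathcomp Require Import all_boot all_order all_fingroup all_solvable.
Set Implicit Arguments. Unset Strict Implicit. Unset Printing Implicit Defensive.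
Import GroupScope.

(** A nontrivial setup is large because g factors through commutators.  Write
    K = G / Z.  The fourth setup axiom forces K to have class at most 2, and
    then it says [z, [y, x]] * delta([z, y], x) = delta([z, x], y).
    Substituting this into the definition of g gives
        g(x, y, z) = gamma([x, y], z), where gamma(c, z) = delta(c, z) * [c, z],
    and gamma is multiplicative in c in G' and in z in G, and trivial for c in
    Z (gammaMl, gammaMr, gamma_central, g_gamma).  As g is alternating and
    invariant under cyclic shifts, a triple with g(a, b, c) <> 1 makes the
    commutators [b, c], [c, a], [a, b] dual to a, b, c with respect to gamma.
    Dual families of three elements produce eight cosets (dual_family_card),
    both in G' modulo Z and in G modulo the preimage of Z(K).  Therefore
    |K'| >= 8 and |K : Z(K)| >= 8; as K' <= Z(K) and |Z| >= 2, this yields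
    |G| = |Z| |K : Z(K)| |Z(K)| >= 2 * 8 * 8 = 128, and equality forces
    |K| = 64 and K' = Z(K) of order 8 (nontrivial_setup_order).

    Conversely let |K| = 64 and let K' = Z(K) have order 8.  Two elements never
    generate K modulo Z(K) (two_generated_proper), so V = K / Z(K) is elementary
    abelian of order 8 and K' is its exterior square, the commutator map being
    the exterior product.  The determinant pairs K' with V, with values in the
    field of two elements.  Choose representatives E(v) of V in K, so that each
    x in K is E(chi(x)) times an element kappa(x) of K'.  The function
        D(x, y) = <kappa(x), chi(y)> + <kappa(y), chi(x)>
    is symmetric, vanishes on the diagonal, is additive as soon as one argument
    is in K', and satisfies D([x, y], z) = det(x, y, z)
    (basis_det_pairing).  On G = K x C_2 with Z = 1 x C_2 it defines a setup in
    which f = g is the determinant, and nondegeneracy of the determinant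
    computes both radicals and Mul (prod_scenario_i).  This G has order 128,
    hence is minimal.

    That minimal setups have order at most 128 requires one group K of this
    kind; it is the central extension of V by its exterior square given by a
    bilinear cocycle whose antisymmetrization is the exterior product
    (twisted_der). *)

(** * Dual families, and commutators in class 2 *)

(** If phi_j(u_i) = 1 exactly for i <> j, then phi_j tells whether j belongs to
    S from the value on the product of the u_i with i in S, so distinct sets S
    give distinct cosets of A. *)
Lemma dual_family_card (gT rT : finGroupType) (H A : {group gT}) (I : finType)
    (phi : I -> gT -> rT) (u : I -> gT) :
    A \subset H ->
    (forall i, {in H &, {morph phi i : x y / x * y}}) ->
    (forall i, {in A, forall x, phi i x = 1}) ->
    (forall i, u i \in H) ->
    (forall i j, (phi j (u i) == 1) = (i != j)) ->
  2 ^ #|I| * #|A| <= #|H|.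
Proof.
move=> sAH phiM phiA Hu dual.
have phi1 j : phi j 1 = 1 by apply: phiA.
pose w (S : {set I}) := \prod_(i in S) u i.
have Hw S : w S \in H by apply: group_prod.
have phiw j S : (phi j (w S) == 1) = (j \notin S).
  have memH r : \prod_(i <- r | i \in S) u i \in H by apply: group_prod.
  have ->: phi j (w S) = \prod_(i in S) phi j (u i).
    rewrite /w /index_enum; elim: (locked_with _ _) => [|i r IHr].
      by rewrite !big_nil.
    by rewrite !big_cons; case: ifP => // Si; rewrite phiM // IHr.
  have [Sj | nSj] := boolP (j \in S).
    have dj i : i != j -> phi j (u i) = 1 by rewrite -dual => /eqP.
    have ->: \prod_(i in S) phi j (u i)
           = \prod_(i in S) (if i == j then phi j (u j) else 1).
      by apply: eq_bigr => i _; case: eqVneq => [-> // | /dj].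
    rewrite -big_mkcondr /= (big_pred1 j) ?dual ?eqxx // => i.
    by rewrite /=; case: eqVneq => [-> | _]; rewrite ?Sj ?andbF.
  by rewrite big1 ?eqxx // => i Si; apply/eqP; rewrite dual; apply: contra nSj => /eqP<-.
have phiE j S x : x \in A :* w S -> phi j x = phi j (w S).
  case/rcosetP=> a Aa ->; rewrite phiM ?(phiA j a Aa) ?mul1g //.
  exact: (subsetP sAH).
have injw : injective (fun S => A :* w S).
  move=> S T eqST; apply/setP=> j; apply: negb_inj; rewrite -!phiw.
  by rewrite (phiE j T (w S)) //= -eqST rcoset_refl.
rewrite -(Lagrange sAH) mulnC leq_mul2l; apply/orP; right.
rewrite -cardsT -card_powerset powersetT -(card_imset _ injw).
by apply/subset_leq_card/subsetP=> _ /imsetP[S _ ->]; rewrite mem_rcosets mulSGid.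
Qed.

Lemma mulg_swap (gT : groupType) (a b c e : gT) :
  commute b c -> a * b * (c * e) = a * c * (b * e).
Proof. by move=> cbc; rewrite -!mulgA; congr (_ * _); rewrite !mulgA cbc. Qed.

(** Conjugating x multiplies it by a central commutator, which no commutator
    detects. *)
Lemma class2_commJ (hT : finGroupType) (K : {group hT}) x y u :
  K^`(1) \subset 'Z(K) -> x \in K -> y \in K -> u \in K ->
  [~ x ^ u, y] = [~ x, y].
Proof.
move=> /subsetP sK'Z Kx Ky Ku.
have cK c v : c \in 'Z(K) -> v \in K -> commute c v by case/centerP=> _; apply.
have Zxu : [~ x, u] \in 'Z(K) by rewrite sK'Z ?mem_commg.
rewrite conjg_mulR commMgJ; have /eqP -> : [~ x, u, y] == 1 by apply/commgP/cK.
rewrite mulg1; apply/conjg_fixP/commgP/commute_sym; apply: cK => //.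
exact: groupR.
Qed.

(** * The lower bound on the order of a nontrivial setup *)

Section Gamma.
Variables (gT : finGroupType) (G Z : {group gT}).
Variable delta : coset_of Z -> coset_of Z -> gT.
Hypothesis setupG : is_setup G delta.
Local Notation d := (delta_on delta).

Let cZG : Z \subset 'C(G).
Proof. exact: subset_trans (setup_central setupG) (subsetIr _ _). Qed.
Let sZG : Z \subset G.
Proof. exact: subset_trans (setup_central setupG) (subsetIl _ _). Qed.
Let nZG : G \subset 'N(Z). Proof. by rewrite cents_norm // centsC. Qed.
Let dZ : {in G &, forall x y, d x y \in Z}.
Proof. by move=> x y Gx Gy; apply: (setup_codomain setupG); apply: mem_quotient. Qed.
Let comZ z x : z \in Z -> x \in G -> commute z x.
Proof. by move=> Zz Gx; apply: (centsP cZG). Qed.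
Let cosM : {in G &, {morph coset Z : x y / x * y}}.
Proof. by move=> x y Gx Gy; rewrite /= morphM ?(subsetP nZG). Qed.

(** Modulo Z the values of delta disappear from the fourth axiom, which becomes
    z^(yx) = z^(xy); and [u, v] is the quotient of u^-1 v^-1 by v^-1 u^-1. *)
Lemma setup_quotient_class2 : (G / Z)^`(1) \subset 'Z(G / Z).
Proof.
have conjE : {in G / Z & &, forall x y z, z ^ (y * x) = z ^ (x * y)}.
  move=> _ _ _ /morphimP[x nx Gx ->] /morphimP[y ny Gy ->] /morphimP[z nz Gz ->].
  rewrite /= -!morphM // -!morphJ ?groupM //=.
  have := setup_conj setupG Gx Gy Gz => /(congr1 (coset Z)).
  have cosMd u v w : u \in G -> v \in G -> w \in G ->
      coset Z (u * d v w) = coset Z u.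
    move=> Gu Gv Gw; rewrite cosM ?(coset_id (dZ Gv Gw)) ?mulg1 //.
    by apply: (subsetP sZG); apply: dZ.
  by rewrite !cosMd ?groupR ?groupJ ?groupM.
rewrite subsetI der_sub /= gen_subG; apply/subsetP=> _ /imset2P[u v Ku Kv ->].
apply/centP=> z Kz; apply/commute_sym/commgP/conjg_fixP.
have ->: [~ u, v] = (u^-1 * v^-1) * (v^-1 * u^-1)^-1.
  by rewrite invMg !invgK commgEl conjgE !mulgA.
by rewrite conjgM conjE ?groupV // -conjgM mulgV conjg1.
Qed.

Lemma setup_commutator_mem c z : c \in G^`(1) -> z \in G -> [~ c, z] \in Z.
Proof.
move=> G'c Gz; have Gc := subsetP (der_sub 1 G) c G'c.
have Nx x : x \in G -> x \in 'N(Z) by apply: (subsetP nZG).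
rewrite coset_idr ?Nx ?groupR // morphR ?Nx //; apply/eqP/commgP.
have: coset Z c \in 'Z(G / Z).
  apply: (subsetP setup_quotient_class2).
  by rewrite -quotient_der // mem_quotient.
by case/centerP=> _; apply; apply: mem_quotient.
Qed.

(** The correction of delta by the commutator that makes it carry g; see
    g_gamma. *)
Definition gamma c z := d c z * [~ c, z].

Lemma deltaMl c e z : c \in G^`(1) -> e \in G -> z \in G -> d (c * e) z = d c z * d e z.
Proof.
move=> G'c Ge Gz; apply: (setup_mul setupG); rewrite ?G'c //.
exact: (subsetP (der_sub 1 G)).
Qed.

Lemma deltaMr c y z : c \in G^`(1) -> y \in G -> z \in G -> d c (y * z) = d c y * d c z.
Proof.
move=> G'c Gy Gz; have Gc := subsetP (der_sub 1 G) c G'c.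
rewrite (setup_skew setupG) ?groupM // (setup_mul setupG) ?G'c ?orbT //.
rewrite invMg -!(setup_skew setupG) //.
by apply: comZ; [apply: dZ | apply/(subsetP sZG)/dZ].
Qed.

Lemma delta1l z : z \in G -> d 1 z = 1.
Proof.
move=> Gz; apply: (mulgI (d 1 z)).
by rewrite -deltaMl ?mulg1 // group1.
Qed.

Lemma delta_coset x x' y : coset Z x = coset Z x' -> d x y = d x' y.
Proof. by rewrite /delta_on => ->. Qed.

Let conjZ c z : c \in Z -> z \in G -> c ^ z = c.
Proof. by move=> Zc Gz; apply/conjg_fixP/commgP/comZ. Qed.

Lemma gammaMl z : z \in G -> {in G^`(1) &, {morph gamma^~ z : c e / c * e}}.
Proof.
move=> Gz c e G'c G'e; have sG := subsetP (der_sub 1 G).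
have Zcz := setup_commutator_mem G'c Gz; have Gcz := subsetP sZG _ Zcz.
rewrite /= /gamma deltaMl // ?sG // commMgJ (conjZ Zcz) // ?sG //.
by apply: mulg_swap; apply/commute_sym/comZ; rewrite ?(subsetP sZG) ?dZ // sG.
Qed.

Lemma gammaMr c : c \in G^`(1) -> {in G &, {morph gamma c : y z / y * z}}.
Proof.
move=> G'c y z Gy Gz; have Gc := subsetP (der_sub 1 G) c G'c.
have Zcy := setup_commutator_mem G'c Gy; have Zcz := setup_commutator_mem G'c Gz.
have GZ := subsetP sZG.
rewrite /gamma deltaMr // commgMJ (conjZ Zcy) // (comZ Zcz) ?GZ //.
by apply: mulg_swap; apply/commute_sym/comZ; rewrite ?GZ ?dZ.
Qed.

Lemma gamma_mem c z : c \in G^`(1) -> z \in G -> gamma c z \in Z.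
Proof.
move=> G'c Gz; apply: groupM; last exact: setup_commutator_mem.
by apply: dZ => //; apply: (subsetP (der_sub 1 G)).
Qed.

Lemma gamma_central c z : c \in Z -> z \in G -> gamma c z = 1.
Proof.
move=> Zc Gz; rewrite /gamma; have /eqP -> : [~ c, z] == 1 by apply/commgP/comZ.
rewrite mulg1 -(delta1l Gz); apply: delta_coset.
by rewrite coset_id ?morph1.
Qed.

Lemma deltaVl c z : c \in G^`(1) -> z \in G -> d c^-1 z = (d c z)^-1.
Proof.
move=> G'c Gz; apply: (mulIg (d c z)).
have Gc := subsetP (der_sub 1 G) c G'c.
by rewrite -deltaMl ?groupV // !mulVg delta1l.
Qed.

(** This is the fourth axiom at z^((xy)^-1) instead of z: the conjugates become z
    and z^[y, x], and conjugating z does not change the coset of [z, y]. *)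
Lemma triple_commutator_delta :
  {in G & &, forall x y z, [~ z, [~ y, x]] * d [~ z, y] x = d [~ z, x] y}.
Proof.
have Nx x : x \in G -> x \in 'N(Z) by apply: (subsetP nZG).
have dJ x y z u : x \in G -> y \in G -> z \in G -> u \in G ->
    d [~ z ^ u, y] x = d [~ z, y] x.
  move=> Gx Gy Gz Gu; apply: delta_coset.
  rewrite /= !morphR ?groupJ ?Nx // morphJ ?Nx //=.
  by apply: (class2_commJ setup_quotient_class2); apply: mem_quotient.
move=> x y z Gx Gy Gz; set u := x * y.
have Gu : u \in G by apply: groupM.
have Gw : z ^ u^-1 \in G by rewrite groupJ ?groupV.
have := setup_conj setupG Gx Gy Gw.
have ->: y * x = u * [~ y, x] by rewrite commgEl conjgE /u !mulgA mulgK mulgV mul1g.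
rewrite conjgM conjgKV !dJ ?groupV // [z ^ [~ y, x]]conjg_mulR -mulgA.
by move/mulgI.
Qed.

(** In g, the factors delta([y, z], x) and delta([z, x], y) combine to the triple
    commutator of triple_commutator_delta, which is [[x, y], z]. *)
Lemma g_gamma : {in G & &, forall x y z, g delta x y z = gamma [~ x, y] z}.
Proof.
move=> x y z Gx Gy Gz; rewrite /g /f -(triple_commutator_delta Gx Gy Gz) -mulgA.
have G'c u v : u \in G -> v \in G -> [~ u, v] \in G^`(1) by apply: mem_commg.
have Zc := setup_commutator_mem (G'c x y Gx Gy) Gz.
have ->: [~ z, [~ y, x]] = [~ [~ x, y], z].
  rewrite -invg_comm; apply/eqP; rewrite eq_invg_mul -[[~ y, x]]invg_comm.
  have Zv : [~ [~ x, y]^-1, z] \in Z.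
    by rewrite setup_commutator_mem // groupV G'c.
  by rewrite -(conjZ Zv (groupR Gx Gy)) -commMgJ mulVg comm1g.
rewrite -[[~ y, z]]invg_comm deltaVl ?G'c //; congr (_ * _).
rewrite (comZ Zc) ?(subsetP sZG) ?dZ ?groupR //.
by rewrite mulKg.
Qed.

Lemma g_cyclic : {in G & &, forall x y z, g delta x y z = g delta y z x}.
Proof.
move=> x y z Gx Gy Gz; rewrite /g /f -!mulgA.
by rewrite (comZ (dZ (groupR Gx Gy) Gz)) ?mulgA ?(subsetP sZG) ?groupM ?dZ ?groupR.
Qed.

Lemma g_alternating : {in G &, forall x y, g delta x y y = 1}.
Proof.
move=> x y Gx Gy; rewrite /g /f commgg delta1l // mulg1.
by rewrite -[[~ y, x]]invg_comm deltaVl ?mem_commg // mulgV.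
Qed.

(** With e0 = (a, b, c) and e1, e2 its cyclic shifts, gamma([e1 i, e2 i], e0 j)
    is trivial exactly for i <> j.  Both bounds read this one duality: the first
    with the commutators as elements and the e0 j as characters, the second with
    the roles exchanged. *)
Lemma nontrivial_setup_bounds : ~ {in G & &, forall x y z, g delta x y z = 1} ->
  [/\ 1 < #|Z|, 8 <= #|(G / Z)^`(1)| & 8 * #|'Z(G / Z)| <= #|G / Z|].
Proof.
move=> nt_g.
have [a [b [c [Ga Gb Gc gabc]]]]:
    exists a b c, [/\ a \in G, b \in G, c \in G & g delta a b c != 1].
  case: (boolP [exists a in G, exists b in G, exists c in G, g delta a b c != 1]).
    case/exists_inP=> a Ga /exists_inP[b Gb /exists_inP[c Gc gabc]].
    by exists a, b, c.
  move=> gtriv; case: nt_g => a b c Ga Gb Gc.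
  apply: contraNeq gtriv => gabc; apply/exists_inP; exists a => //.
  by apply/exists_inP; exists b => //; apply/exists_inP; exists c.
pose e0 (i : 'I_3) := nth 1 [:: a; b; c] i.
pose e1 (i : 'I_3) := nth 1 [:: b; c; a] i.
pose e2 (i : 'I_3) := nth 1 [:: c; a; b] i.
have Ge i : [/\ e0 i \in G, e1 i \in G & e2 i \in G] by case: i => [[|[|[]]]].
have G'e i : [~ e1 i, e2 i] \in G^`(1) by have [_ G1 G2] := Ge i; apply: mem_commg.
have gxyx : {in G &, forall x y, g delta x y x = 1}.
  by move=> x y Gx Gy; rewrite g_cyclic // g_alternating.
have dual i j : (gamma [~ e1 i, e2 i] (e0 j) == 1) = (i != j).
  have [_ G1 G2] := Ge i; have [G0 _ _] := Ge j; rewrite -g_gamma //.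
  move: gabc; rewrite (g_cyclic Ga Gb Gc) => gbca.
  have gcab: g delta c a b != 1 by rewrite -g_cyclic // -g_cyclic.
  have gabc: g delta a b c != 1 by rewrite -g_cyclic.
  clear G0 G1 G2; move: i j => [[|[|[]]] // ?] [[|[|[]]] // ?];
    by rewrite /e0 /e1 /e2 /= ?g_alternating ?gxyx ?eqxx ?(negPf gbca)
                ?(negPf gcab) ?(negPf gabc).
have nsZG : Z <| G by apply/andP.
split.
- rewrite cardG_gt1; apply/trivgPn; exists (g delta a b c) => //.
  by rewrite g_gamma // gamma_mem ?mem_commg.
- have := @dual_family_card _ _ G^`(1)%G (G^`(1) :&: Z)%G 'I_3
    (fun j x => gamma x (e0 j)) (fun i => [~ e1 i, e2 i]).
  rewrite card_ord => /(_ (subsetIl _ _)) le8.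
  have {}le8: 8 * #|G^`(1) :&: Z| <= #|G^`(1)|.
    apply: le8 => //= j; first by apply: gammaMl; have [] := Ge j.
    by move=> x /setIP[_ Zx]; apply: gamma_central => //; have [] := Ge j.
  have nZG' := subset_trans (der_sub 1 G) nZG.
  rewrite -quotient_der // card_quotient // -(leq_pmul2r (cardG_gt0 (G^`(1) :&: Z)%G)).
  by apply: leq_trans le8 _; rewrite mulnC LagrangeI.
pose C := (coset Z @*^-1 'Z(G / Z))%G.
have sCG : C \subset G by rewrite -(quotientGK nsZG) morphpreS ?center_sub.
have := @dual_family_card _ _ G C 'I_3
    (fun j => gamma [~ e1 j, e2 j]) e0 sCG.
rewrite card_ord card_cosetpre mulnCA => le8.
have {}le8: #|Z| * (8 * #|'Z(G / Z)|) <= #|G|.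
  apply: le8 => [j | j x | i | i j] /=; last by rewrite dual eq_sym.
  - exact: gammaMr.
  - move=> Cx; have [_ G1 G2] := Ge j; have Gx := subsetP sCG x Cx.
    (* A cyclic shift moves x into the commutator, which then lies in Z. *)
    rewrite -g_gamma // g_cyclic // g_gamma // gamma_central //.
    have [Nx /centerP[_ cKx]] := morphpreP Cx; have N2 := subsetP nZG _ G2.
    rewrite coset_idr ?groupR // morphR //; apply/eqP/commgP/commute_sym/cKx.
    exact: mem_quotient.
  by have [] := Ge i.
by rewrite -(leq_pmul2l (cardG_gt0 Z)) (card_quotient nZG) Lagrange.
Qed.

End Gamma.

(** From |G| = |Z| |K : Z(K)| |Z(K)| and K' <= Z(K), where K = G / Z; in the case
    of equality every factor takes its least value. *)
Lemma nontrivial_setup_order (gT : finGroupType) (G Z : {group gT})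
    (delta : coset_of Z -> coset_of Z -> gT) :
  nontrivial_setup G delta ->
  128 <= #|G| /\
  (#|G| <= 128 -> [/\ #|G / Z| = 64, #|(G / Z)^`(1)| = 8 & (G / Z)^`(1) = 'Z(G / Z)]).
Proof.
case=> setupG nt_g; have [Z2 K'8 KZ8] := nontrivial_setup_bounds setupG nt_g.
have sK'Z := setup_quotient_class2 setupG.
have sZZ := setup_central setupG.
have oG : #|G| = (#|Z| * #|G / Z|)%N.
  rewrite card_quotient ?Lagrange ?(subset_trans sZZ) ?center_sub //.
  by rewrite cents_norm // centsC (subset_trans sZZ) ?subsetIr.
have leK'Z := subset_leq_card sK'Z.
have K64 : 64 <= #|G / Z|.
  exact: leq_trans (leq_mul (leqnn 8) (leq_trans K'8 leK'Z)) KZ8.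
split=> [|leG]; first by rewrite oG (leq_mul Z2 K64).
have K64' : #|G / Z| <= 64.
  by rewrite -(leq_pmul2l (isT : 0 < 2)) (leq_trans _ leG) // oG leq_pmul2r.
have oZK : #|'Z(G / Z)| <= 8.
  by rewrite -(leq_pmul2l (isT : 0 < 8)) (leq_trans KZ8).
have eqK'Z : (G / Z)^`(1) = 'Z(G / Z).
  by apply/eqP; rewrite eqEcard sK'Z (leq_trans oZK).
split=> //; first by apply/eqP; rewrite eqn_leq K64'.
by apply/eqP; rewrite eqn_leq K'8 eqK'Z oZK.
Qed.

(** * The exterior algebra of a 3-dimensional space over two elements *)

(** Triples of bits serve both as V and as its exterior square, the latter in the
    basis dual to that of V.  Then cross is the exterior product, dot pairs the
    square with V, and dot (cross u v) w is the determinant of u, v, w. *)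
Definition bool3 := (bool * bool * bool)%type.
HB.instance Definition _ := FinGroup.on bool3.

Definition dot (v w : bool3) : bool :=
  let: (v1, v2, v3) := v in let: (w1, w2, w3) := w in
  (v1 && w1) (+) (v2 && w2) (+) (v3 && w3).

Definition cross (v w : bool3) : bool3 :=
  let: (v1, v2, v3) := v in let: (w1, w2, w3) := w in
  ((v2 && w3) (+) (v3 && w2), (v3 && w1) (+) (v1 && w3), (v1 && w2) (+) (v2 && w1)).

Lemma dotMl u v w : dot (u * v) w = dot u w (+) dot v w.
Proof. by move: u v w => [[[] []] []] [[[] []] []] [[[] []] []]. Qed.

Lemma dotC u v : dot u v = dot v u.
Proof. by move: u v => [[[] []] []] [[[] []] []]. Qed.

Lemma dot_cross_swap u v w : dot (cross u v) w = dot (cross u w) v.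
Proof. by move: u v w => [[[] []] []] [[[] []] []] [[[] []] []]. Qed.

Lemma dot_eq0 v : (forall w, dot v w = false) -> v = 1.
Proof.
move=> v0; have := (v0 (true, false, false), v0 (false, true, false),
  v0 (false, false, true)).
by move: v {v0} => [[[] []] []] [[]].
Qed.

(** In dimension 3 every bivector is decomposable. *)
Lemma cross_surj v : exists u1 u2, v = cross u1 u2.
Proof.
by move: v => [[[] []] []];
  [ exists (true, true, false), (false, true, true)
  | exists (true, true, true), (false, false, true)
  | exists (true, true, true), (false, true, false)
  | exists (false, true, false), (false, false, true)
  | exists (true, true, true), (true, false, false)
  | exists (true, false, false), (false, false, true)
  | exists (true, false, false), (false, true, false)
  | exists 1, 1 ].
Qed.

Lemma dot_cross_eq0 w : (forall u v, dot (cross u v) w = false) -> w = 1.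
Proof.
move=> w0; apply: dot_eq0 => v; rewrite dotC.
by have [u1 [u2 ->]] := cross_surj v.
Qed.

(** * Coordinates on groups with K' = Z(K) of order 8 and index 8 *)

Lemma bool_expgM (gT : finGroupType) (x : gT) (e f : bool) :
  x ^+ 2 = 1 -> x ^+ (e * f)%g = x ^+ e * x ^+ f.
Proof. by move=> x2; case: e f => [] []; rewrite ?expg0 ?mulg1 ?mul1g. Qed.

Lemma bool3_morph_ext (gT : finGroupType) (phi psi : bool3 -> gT) :
  {morph phi : x y / x * y} -> {morph psi : x y / x * y} ->
  phi (true, false, false) = psi (true, false, false) ->
  phi (false, true, false) = psi (false, true, false) ->
  phi (false, false, true) = psi (false, false, true) -> phi =1 psi.
Proof.
move=> phiM psiM e1 e2 e3 v.
have ->: v = (v.1.1, false, false) * (false, v.1.2, false) * (false, false, v.2).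
  by move: v => [[[] []] []].
have phi1 : phi 1 = 1 by apply: (mulgI (phi 1)); rewrite -phiM !mulg1.
have psi1 : psi 1 = 1 by apply: (mulgI (psi 1)); rewrite -psiM !mulg1.
rewrite !phiM !psiM; congr (_ * _ * _).
- by case: v.1.1 => //; rewrite [LHS]phi1 [RHS]psi1.
- by case: v.1.2 => //; rewrite [LHS]phi1 [RHS]psi1.
by case: v.2 => //; rewrite [LHS]phi1 [RHS]psi1.
Qed.

(** The cosets M and M c are disjoint; iterating this along a chain of subgroups
    separates the coordinates of an element. *)
Lemma coset_peel (gT : finGroupType) (M : {group gT}) (c u v n m : gT) (e f : bool) :
  c \notin M -> u \in M -> v \in M -> n \in M -> m \in M ->
  commute c n -> commute c m ->
  u * c ^+ e * n = v * c ^+ f * m -> e = f /\ u * n = v * m.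
Proof.
move=> nMc Mu Mv Mn Mm cn cm; rewrite -!mulgA.
case: e f => [] []; rewrite ?expg1 ?expg0 ?mul1g; last by [].
- by rewrite cn cm !mulgA => /mulIg.
- by move/(congr1 (fun x => x \in M)); rewrite groupMl // groupMr // (negPf nMc) groupM.
by move/(congr1 (fun x => x \in M)); rewrite groupMl // groupMl // groupMr //
  (negPf nMc) Mn.
Qed.

(** Read as a map into C_2, such a D is the map delta of a setup on K x C_2.  It
    extends the determinant D([x, y], z); the last two fields say that the
    determinant is nondegenerate on either side. *)
Record det_pairing (kT : finGroupType) (K : {group kT}) (D : kT -> kT -> bool) : Prop :=
  DetPairing {
  det_pairing_diag : {in K, forall x, D x x = false};
  det_pairing_sym : {in K &, forall x y, D x y = D y x};
  det_pairing_mul : {in K & &, forall x y z,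
    [|| x \in K^`(1), y \in K^`(1) | z \in K^`(1)] ->
    D (x * y) z = D x z (+) D y z};
  det_pairing_swap : {in K & &, forall x y z, D [~ x, y] z = D [~ x, z] y};
  det_pairing_radl : {in K^`(1), forall c, {in K, forall z, D c z = false} -> c = 1};
  det_pairing_radr : {in K, forall z,
    {in K &, forall x y, D [~ x, y] z = false} -> z \in K^`(1)}
}.

Section Coordinates.
Variables (kT : finGroupType) (K : {group kT}).
Hypotheses (oK : #|K| = 64) (oK' : #|K^`(1)| = 8) (K'Z : K^`(1) = 'Z(K)).

Let oZ : #|'Z(K)| = 8. Proof. by rewrite -K'Z. Qed.

(** Otherwise K' would be cyclic of order 8, generated by [x, y].  Then
    [x^4, y] <> 1, so x has order 8 in K / Z(K); this quotient is then cyclic and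
    K is abelian. *)
Lemma two_generated_proper x y :
  x \in K -> y \in K -> <[x]> <*> <[y]> <*> 'Z(K) \proper K.
Proof.
move=> Kx Ky; rewrite properEneq join_subG center_sub join_subG !cycle_subG Kx Ky !andbT.
apply/eqP=> genK; set XY := <[x]> <*> <[y]> in genK.
have Zxy : [~ x, y] \in 'Z(K) by rewrite -K'Z mem_commg.
have sXYK : XY \subset K by rewrite join_subG !cycle_subG Kx.
have cXY : 'Z(K) \subset 'C(XY) by rewrite (subset_trans (subsetIr _ _)) ?centS.
have /centerP[_ cK] := Zxy.
(* The central factor Z(K) contributes nothing to K', so K' is the derived
   subgroup of <x, y>, generated by [x, y]. *)
have defK : XY \* 'Z(K) = K by rewrite cprodEY.
have := der_cprod 1 defK.
rewrite (derG1P (center_abelian K)) cprodg1 der1_joing_cycles; last exact: (subsetP cXY).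
move=> defK'; have oxy : #[[~ x, y]] = 8 by rewrite -oK' -defK'.
have x4 : coset 'Z(K) x ^+ 4 != 1.
  have Nx : x \in 'N('Z(K)) by apply: (subsetP (gFnorm _ _)).
  rewrite -morphX //; apply/eqP=> /coset_idr; rewrite groupX //.
  move=> /(_ isT) /centerP[_ cx4].
  have: [~ x ^+ 4, y] == 1 by apply/commgP/cx4.
  rewrite commXg; last by apply/commute_sym/cK.
  by rewrite -order_dvdn oxy.
have oQ : #|K / 'Z(K)| = 8.
  by rewrite card_quotient ?gFnorm // -divgS ?center_sub // oK oZ.
have Qx : coset 'Z(K) x \in K / 'Z(K) by rewrite mem_quotient.
have : #[coset 'Z(K) x] %| (2 ^ 3)%N.
  by rewrite (_ : (2 ^ 3)%N = #|K / 'Z(K)|) ?order_dvdG.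
case/(dvdn_pfactor _ _ (isT : prime 2)) => m lem ox.
have m3 : m = 3.
  move: x4; rewrite -order_dvdn ox; case: (m) lem => [|[|[|[|]]]] //.
have: cyclic (K / 'Z(K)).
  apply/cyclicP; exists (coset 'Z(K) x); apply/esym/eqP.
  by rewrite eqEcard cycle_subG Qx -orderE ox oQ m3.
by move/cyclic_center_factor_abelian/derG1P=> K'1; move: oK'; rewrite K'1 cards1.
Qed.

(** In K / Z(K), of order 8, there is room for two proper inclusions above the
    image of <x>, by two_generated_proper.  So this image has order at most 2. *)
Lemma square_central x : x \in K -> x ^+ 2 \in 'Z(K).
Proof.
move=> Kx; have [|nZx] := boolP (x \in 'Z(K)); first exact: groupX.
pose A := <[x]> <*> 'Z(K).
have sZA : 'Z(K) \subset A by apply: joing_subr.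
have Ax : x \in A by rewrite mem_gen // inE cycle_id.
have sAxy y : A \subset <[x]> <*> <[y]> <*> 'Z(K).
  by rewrite join_subG joing_subr andbT (subset_trans _ (joing_subl _ _)) ?joing_subl.
have /properP[sAK [y Ky nAy]] : A \proper K.
  exact: sub_proper_trans (sAxy x) (two_generated_proper Kx Kx).
have prBK := two_generated_proper Kx Ky; set B := _ <*> _ in prBK.
have sAB : A \subset B by apply: sAxy.
have By : y \in B.
  by rewrite (subsetP (joing_subl _ _)) // (subsetP (joing_subr _ _)) // cycle_id.
have iAZ : 1 < #|A : 'Z(K)| by rewrite indexg_gt1; apply: contra nZx => /subsetP->.
have iBA : 1 < #|B : A| by rewrite indexg_gt1; apply: contra nAy => /subsetP->.
have iKB : 1 < #|K : B| by rewrite indexg_gt1 proper_subn.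
have: (#|K : B| * (#|B : A| * #|A : 'Z(K)|) = 8)%N.
  have sZB := subset_trans sZA sAB; have sBK := proper_sub prBK.
  by rewrite !Lagrange_index // -divgS ?center_sub // oK oZ.
have nZA : A \subset 'N('Z(K)) by rewrite (subset_trans sAK) ?gFnorm.
move=> i8; have iAZ2 : #|A / 'Z(K)| = 2.
  rewrite card_quotient //; apply/eqP; rewrite eqn_leq iAZ andbT.
  rewrite -(leq_pmul2l (isT : 0 < 4)) -[(4 * 2)%N]i8 mulnA leq_mul2r.
  by rewrite (leq_mul iKB iBA) orbT.
apply: coset_idr; first by rewrite groupX ?(subsetP nZA).
rewrite morphX ?(subsetP nZA) //= -iAZ2; apply: expg_cardG.
exact: mem_quotient.
Qed.

Lemma exists_independent_triple : exists a b c,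
  [/\ [/\ a \in K, b \in K & c \in K], a \notin 'Z(K), b \notin <[a]> <*> 'Z(K)
   & c \notin <[a]> <*> <[b]> <*> 'Z(K)].
Proof.
have ntK : ~~ (K \subset 'Z(K)).
  by apply/negP=> /subset_leq_card; rewrite oK oZ.
have [a Ka nZa] := subsetPn ntK.
have [_ [b Kb nAb]] := properP (two_generated_proper Ka Ka).
have [_ [c Kc nBc]] := properP (two_generated_proper Ka Kb).
exists a, b, c; split=> //; apply: contra nAb; apply: subsetP.
by rewrite join_subG joing_subr andbT (subset_trans _ (joing_subl _ _)) ?joing_subl.
Qed.

Section Basis.
Variables a b c : kT.
Hypotheses (Ka : a \in K) (Kb : b \in K) (Kc : c \in K).
Hypotheses (nZa : a \notin 'Z(K)) (nAb : b \notin <[a]> <*> 'Z(K)).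
Hypothesis nBc : c \notin <[a]> <*> <[b]> <*> 'Z(K).

(** The section of K -> V attached to the basis a, b, c of V. *)
Definition basis_elt (v : bool3) : kT := a ^+ v.1.1 * b ^+ v.1.2 * c ^+ v.2.
(** The isomorphism of the exterior square of V onto K' attached to a, b, c; its
    basis is dual to a, b, c. *)
Definition comm_elt (p : bool3) : kT :=
  [~ b, c] ^+ p.1.1 * [~ c, a] ^+ p.1.2 * [~ a, b] ^+ p.2.
Local Notation E := basis_elt.
Local Notation F := comm_elt.

Let cZ z x : z \in 'Z(K) -> x \in K -> commute z x.
Proof. by case/centerP=> _; apply. Qed.
Let ZK : {subset 'Z(K) <= K}. Proof. by apply/subsetP/center_sub. Qed.
Let Zcomm x y : x \in K -> y \in K -> [~ x, y] \in 'Z(K).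
Proof. by move=> Kx Ky; rewrite -K'Z mem_commg. Qed.
Let KE v : E v \in K. Proof. by rewrite !groupM ?groupX. Qed.
Let ZF p : F p \in 'Z(K). Proof. by rewrite !groupM ?groupX ?Zcomm. Qed.
Let E1 : E 1 = 1. Proof. by rewrite /E !mulg1. Qed.
Let F1 : F 1 = 1. Proof. by rewrite /F !mulg1. Qed.

Lemma basis_elt_inj v w n m : n \in 'Z(K) -> m \in 'Z(K) ->
  E v * n = E w * m -> v = w.
Proof.
move: v w => [[v1 v2] v3] [[w1 w2] w3] Zn Zm; rewrite /E /=.
pose B := (<[a]> <*> <[b]> <*> 'Z(K))%G; pose A := (<[a]> <*> 'Z(K))%G.
have sZB : {subset 'Z(K) <= B} by apply/subsetP/joing_subr.
have sZA : {subset 'Z(K) <= A} by apply/subsetP/joing_subr.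
have Aa : a \in A by rewrite mem_gen // inE cycle_id.
have Ba : a \in B by rewrite mem_gen // inE mem_gen // inE cycle_id.
have Bb : b \in B by rewrite mem_gen // inE mem_gen // inE cycle_id orbT.
have com x z : x \in K -> z \in 'Z(K) -> commute x z by move=> *; apply/commute_sym/cZ.
case/(coset_peel (M := B)) => //; rewrite ?groupM ?groupX ?(sZB _ Zn) ?(sZB _ Zm) //;
  try exact: com.
move=> ->; case/(coset_peel (M := A)) => //; rewrite ?groupX ?(sZA _ Zn) ?(sZA _ Zm) //;
  try exact: com.
move=> ->; rewrite -[a ^+ v1]mul1g -[a ^+ w1]mul1g.
by case/(coset_peel (M := ('Z(K))%G)) => //; try exact: com; move=> ->.
Qed.

Lemma comm_sqr x y : x \in K -> y \in K -> [~ x, y] ^+ 2 = 1.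
Proof.
move=> Kx Ky; rewrite -commXg; last by apply/commute_sym/cZ => //; apply: Zcomm.
by apply/eqP/commgP/cZ => //; apply: square_central.
Qed.

Lemma comm_eltM : {morph F : p q / p * q}.
Proof.
have ZX x y (e : bool) : x \in K -> y \in K -> [~ x, y] ^+ e \in 'Z(K).
  by move=> Kx Ky; rewrite groupX ?Zcomm.
move=> p q; rewrite /F /= !bool_expgM ?comm_sqr //.
have cZZ x y : x \in 'Z(K) -> y \in 'Z(K) -> commute x y.
  by move=> Zx Zy; apply/cZ/ZK.
rewrite [RHS]mulg_swap; last by apply: cZZ; rewrite ?groupM ?ZX.
by congr (_ * _); apply/esym/mulg_swap/cZZ; apply: ZX.
Qed.

Lemma coset_basis_eltM :
  {morph (fun v => coset 'Z(K) (E v)) : v w / v * w}.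
Proof.
have NK x : x \in K -> x \in 'N('Z(K)) by apply/subsetP/gFnorm.
have QE v : coset 'Z(K) (E v) =
    coset 'Z(K) a ^+ v.1.1 * coset 'Z(K) b ^+ v.1.2 * coset 'Z(K) c ^+ v.2.
  by rewrite /E !morphM ?morphX ?groupM ?groupX ?NK.
have sq x : x \in K -> coset 'Z(K) x ^+ 2 = 1.
  by move=> Kx; rewrite -morphX ?NK //= coset_id ?square_central.
have cQ x y e f : x \in K -> y \in K ->
    commute (coset 'Z(K) x ^+ e) (coset 'Z(K) y ^+ f).
  move=> Kx Ky; apply/commuteX/commute_sym/commuteX/commgP.
  by rewrite -morphR ?NK //= coset_id ?Zcomm.
move=> v w; rewrite !QE !bool_expgM ?sq //.
rewrite [RHS]mulg_swap; last by apply: commuteM; apply: cQ.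
by congr (_ * _); apply/esym/mulg_swap/cQ.
Qed.

Lemma basis_eltM v w : exists2 n, n \in 'Z(K) & E v * E w = E (v * w) * n.
Proof.
have NK x : x \in K -> x \in 'N('Z(K)) by apply/subsetP/gFnorm.
exists ((E (v * w))^-1 * (E v * E w)); last by rewrite mulKVg.
have KEE := groupM (KE v) (KE w); have KEV := groupVr (KE (v * w)).
apply: coset_idr; first by rewrite NK // groupM.
rewrite (morphM _ (NK _ KEV) (NK _ KEE)) (morphM _ (NK _ (KE v)) (NK _ (KE w))).
by rewrite (morphV _ (NK _ (KE (v * w)))) /= coset_basis_eltM mulVg.
Qed.

(** Both sides are multiplicative in v and in w, so it suffices to compare them
    on the basis. *)
Lemma comm_basis_elt v w : [~ E v, E w] = F (cross v w).
Proof.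
have commMl : {in K & &, forall x y z, [~ x * y, z] = [~ x, z] * [~ y, z]}.
  move=> x y z Kx Ky Kz; rewrite commMgJ; congr (_ * _).
  by apply/conjg_fixP/commgP/cZ => //; apply: Zcomm.
have commZl n x : n \in 'Z(K) -> x \in K -> [~ n, x] = 1.
  by move=> Zn Kx; apply/eqP/commgP/cZ.
have EMl y : y \in K -> {morph (fun v => [~ E v, y]) : v w / v * w}.
  move=> Ky u t; have [n Zn eqE] := basis_eltM u t.
  rewrite -(commMl _ _ _ (KE u) (KE t) Ky) eqE (commMl _ _ _ (KE _) (ZK Zn) Ky).
  by rewrite (commZl n) ?mulg1.
have commC x y : x \in K -> y \in K -> [~ x, y] = [~ y, x].
  move=> Kx Ky; rewrite -[LHS]invg_comm; apply/eqP; rewrite eq_invg_mul.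
  by rewrite -[_ * _]/(_ ^+ 2) comm_sqr.
have EMr y : y \in K -> {morph (fun v => [~ y, E v]) : v w / v * w}.
  by move=> Ky u t; rewrite /= !(commC y) ?KE // EMl.
have crossMl u : {morph cross^~ u : v w / v * w}.
  by move: u => [[[] []] []] [[[] []] []] [[[] []] []].
have crossMr u : {morph cross u : v w / v * w}.
  by move: u => [[[] []] []] [[[] []] []] [[[] []] []].
have FX : (E (true, false, false) = a) * (E (false, true, false) = b) *
    (E (false, false, true) = c).
  by rewrite /E /= !expg0 !expg1 !mulg1 !mul1g.
have FC : (F (true, false, false) = [~ b, c]) *
    (F (false, true, false) = [~ c, a]) *
    (F (false, false, true) = [~ a, b]).
  by rewrite /F /= !expg0 !expg1 !mulg1 !mul1g.
move: v; apply: bool3_morph_ext => [|x y||| ]; first exact: EMl.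
- by rewrite crossMl comm_eltM.
all: move: w; apply: bool3_morph_ext => [x y | x y |||];
  rewrite ?FX ?crossMr ?comm_eltM ?commgg //.
all: try by rewrite -?[LHS]/1 -[LHS]F1; congr F.
all: try exact: EMr.
all: rewrite [cross _ _]/= !FC //; exact: commC.
Qed.

Lemma comm_mod_center x y n m : x \in K -> y \in K -> n \in 'Z(K) -> m \in 'Z(K) ->
  [~ x * n, y * m] = [~ x, y].
Proof.
move=> Kx Ky Zn Zm; have Kym : y * m \in K by rewrite groupM // ZK.
have comm1 z u : z \in 'Z(K) -> u \in K -> [~ z, u] = 1.
  by move=> Zz Ku; apply/eqP/commgP/cZ.
rewrite commMgJ (comm1 n) // mulg1 commgMJ -[[~ x, m]]invg_comm (comm1 m) //.
rewrite invg1 mul1g -conjgM; apply/conjg_fixP/commgP/commute_sym/cZ.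
  exact: groupM.
exact: groupR.
Qed.

(** The products E v * n with n in Z(K) are 64 distinct elements, so they exhaust
    K.  All commutators are then values of F, and F is surjective onto K'. *)
Lemma basis_coordinates x : x \in K -> exists v p, x = E v * F p.
Proof.
have oE : #|[set E v * n | v in [set: bool3], n in 'Z(K)]| = 64.
  rewrite curry_imset2X card_in_imset ?cardsX ?oZ ?cardsT ?card_prod ?card_bool //.
  move=> [v n] [w m] /setXP[_ Zn] /setXP[_ Zm] /= eqE.
  by have eqv := basis_elt_inj Zn Zm eqE; move: eqE; rewrite eqv => /mulgI->.
have defK : K = [set E v * n | v in [set: bool3], n in 'Z(K)] :> {set kT}.
  apply/esym/eqP; rewrite eqEcard oE oK leqnn andbT.
  by apply/subsetP=> _ /imset2P[v n _ Zn ->]; apply: groupM; [apply: KE | apply: ZK].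
have gF : group_set (F @: [set: bool3]).
  apply/group_setP; split=> [|_ _ /imsetP[p _ ->] /imsetP[q _ ->]].
    by apply/imsetP; exists 1; rewrite ?inE ?F1.
  by rewrite -comm_eltM imset_f ?inE.
have sZF : 'Z(K) \subset F @: [set: bool3].
  rewrite -K'Z -[F @: _]/(gval (Group gF)) gen_subG.
  apply/subsetP=> k /imset2P[y z]; rewrite defK.
  case/imset2P=> v n _ Zn -> /imset2P[w m _ Zm ->] ->.
  by rewrite comm_mod_center ?KE // comm_basis_elt imset_f ?inE.
rewrite defK => /imset2P[v n _ Zn ->].
by have /imsetP[p _ ->] := subsetP sZF n Zn; exists v, p.
Qed.

Lemma comm_elt_inj : injective F.
Proof.
have /imset_injP injF : #|F @: [set: bool3]| == #|[set: bool3]|.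
  rewrite eqn_leq leq_imset_card cardsT !card_prod card_bool -[(_ * _)%N]oZ.
  apply/subset_leq_card/subsetP=> n Zn; have [v [p eq_n]] := basis_coordinates (ZK Zn).
  have v1 : v = 1.
    by apply: (@basis_elt_inj v 1 (F p) n); rewrite ?ZF // E1 mul1g.
  by rewrite eq_n v1 E1 mul1g imset_f ?inE.
by move=> p q; apply: injF; rewrite inE.
Qed.

Lemma basis_coordinates_inj v w p q : E v * F p = E w * F q -> v = w /\ p = q.
Proof.
move=> eqE; have eqv := basis_elt_inj (ZF p) (ZF q) eqE; split=> //.
by move: eqE; rewrite eqv => /mulgI/comm_elt_inj.
Qed.

(** D is built from the coordinates chi in V and kappa in the exterior square of
    V.  While kappa is not multiplicative, it is so when one factor is in K';
    that is what the axioms need.  Symmetrizing keeps the pairing on K' x K,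
    where chi vanishes on the left, and makes D vanish on the diagonal. *)
Lemma basis_det_pairing : exists D, det_pairing K D.
Proof.
have /fin_all_exists[chk chkP] x :
    exists vp : bool3 * bool3, x \in K -> x = E vp.1 * F vp.2.
  have [Kx | nKx] := boolP (x \in K).
    by have [v [p eq_x]] := basis_coordinates Kx; exists (v, p).
  by exists (1, 1).
pose chi x := (chk x).1; pose kappa x := (chk x).2.
have xE x : x \in K -> x = E (chi x) * F (kappa x) by apply: chkP.
have coordK v p : chi (E v * F p) = v /\ kappa (E v * F p) = p.
  have K_ : E v * F p \in K by apply: groupM; [apply: KE | apply/ZK/ZF].
  by have [<- <-] := basis_coordinates_inj (xE _ K_).
have chiM : {in K &, {morph chi : x y / x * y}}.
  move=> x y Kx Ky; rewrite {1}(xE x Kx) {1}(xE y Ky).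
  rewrite mulg_swap; last by apply: cZ; [apply: ZF | apply: KE].
  have [n Zn ->] := basis_eltM (chi x) (chi y).
  have /basis_coordinates [v [p def_n]] := ZK Zn.
  have v1 : v = 1 by apply: (@basis_elt_inj v 1 (F p) n); rewrite ?ZF // E1 mul1g.
  rewrite def_n v1 E1 mul1g -mulgA -!comm_eltM.
  by have [-> _] := coordK (chi x * chi y) (p * (kappa x * kappa y)).
have chi1 x : x \in K -> (chi x = 1) <-> (x \in K^`(1)).
  move=> Kx; split=> [chix | ]; first by rewrite (xE x Kx) chix E1 mul1g K'Z ZF.
  rewrite K'Z => Zx; apply: (@basis_elt_inj _ _ (F (kappa x)) x); rewrite ?ZF //.
  by rewrite E1 mul1g -xE.
have sK'K := subsetP (der_sub 1 K).
have kappaM k x : k \in K^`(1) -> x \in K -> kappa (k * x) = kappa k * kappa x.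
  move=> K'k Kx; rewrite {1}(xE k (sK'K k K'k)) {1}(xE x Kx).
  have /chi1 -> // := K'k; last exact: sK'K.
  rewrite E1 mul1g mulgA (cZ (ZF _) (KE _)) -mulgA -comm_eltM.
  by have [_ ->] := coordK (chi x) (kappa k * kappa x).
have kappa_comm x y : x \in K -> y \in K -> kappa [~ x, y] = cross (chi x) (chi y).
  move=> Kx Ky; rewrite {1}(xE x Kx) {1}(xE y Ky) comm_mod_center ?KE ?ZF //.
  rewrite comm_basis_elt -[F _]mul1g -E1.
  by have [_ ->] := coordK 1 (cross (chi x) (chi y)).
pose D x y := dot (kappa x) (chi y) (+) dot (kappa y) (chi x).
have Dl k x : k \in K^`(1) -> D k x = dot (kappa k) (chi x).
  move=> K'k; rewrite /D; have /chi1 -> // := K'k; last exact: sK'K.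
  by case: (kappa x) => [[[] []] []]; rewrite addbF.
have Dcomm x y z : x \in K -> y \in K ->
    D [~ x, y] z = dot (cross (chi x) (chi y)) (chi z).
  by move=> Kx Ky; rewrite Dl ?mem_commg // kappa_comm.
have Dsym x y : D x y = D y x by rewrite /D addbC.
have DMl k x z : k \in K^`(1) -> x \in K -> z \in K -> D (k * x) z = D k z (+) D x z.
  move=> K'k Kx Kz; have Kk := sK'K k K'k.
  rewrite (Dl k) // /D kappaM // chiM //; have /chi1 -> // := K'k.
  by rewrite mul1g dotMl addbA.
exists D; split.
- by move=> x _; apply: addbb.
- by move=> x y _ _.
- move=> x y z Kx Ky Kz /or3P[K'x | K'y | K'z]; first exact: DMl.
  + have -> : x * y = y * x by apply/esym/cZ; rewrite -?K'Z.
    by rewrite DMl // addbC.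
  by rewrite !(Dsym _ z) !Dl // chiM // !(dotC (kappa z)) dotMl.
- by move=> x y z Kx Ky Kz; rewrite !Dcomm // dot_cross_swap.
- move=> k K'k Dk0; have Kk := sK'K k K'k.
  rewrite (xE k Kk); have /chi1 -> // := K'k.
  rewrite E1 mul1g (_ : kappa k = 1) ?F1 //; apply: dot_eq0 => w.
  have := Dk0 (E w) (KE w); rewrite Dl //.
  by have [] := coordK w 1; rewrite F1 mulg1 => ->.
move=> z Kz D0; apply/chi1 => //; apply: dot_cross_eq0 => u v.
have := D0 (E u) (E v) (KE u) (KE v); rewrite Dcomm ?KE //.
have [] := coordK u 1; rewrite F1 mulg1 => -> _.
by have [] := coordK v 1; rewrite F1 mulg1 => -> _.
Qed.

End Basis.

Lemma exists_det_pairing : exists D, det_pairing K D.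
Proof.
have [a [b [c [[Ka Kb Kc] nZa nAb nBc]]]] := exists_independent_triple.
exact: (@basis_det_pairing a b c).
Qed.

End Coordinates.

(** * The setup on K x C_2 *)

Section ProductSetup.
Variables (kT : finGroupType) (K : {group kT}) (D : kT -> kT -> bool).
Hypotheses (oK : #|K| = 64) (oK' : #|K^`(1)| = 8) (K'Z : K^`(1) = 'Z(K)).
Hypothesis detD : det_pairing K D.

Definition prodG : {group kT * bool} := setX_group K [set: bool]%G.
Definition prodZ : {group kT * bool} := setX_group 1%G [set: bool]%G.
Definition prod_delta (u v : coset_of prodZ) : kT * bool :=
  (1, D (repr u).1 (repr v).1).

Local Notation G := prodG.
Local Notation Z := prodZ.
Local Notation d := (delta_on prod_delta).

Let inG x : (x \in G) = (x.1 \in K).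
Proof. by case: x => x1 x2; rewrite in_setX inE andbT. Qed.
Let inZ x : (x \in Z) = (x.1 == 1).
Proof. by case: x => x1 x2; rewrite in_setX !inE andbT. Qed.

Lemma center_prodG : 'Z(G) = setX 'Z(K) [set: bool].
Proof.
apply/setP=> -[x1 x2]; rewrite in_setX in_setT andbT; apply/centerP/centerP; rewrite inG.
  case=> Kx cx; split=> // y Ky.
  by have := cx (y, 1); rewrite inG => /(_ Ky)/(congr1 fst).
case=> Kx cx; split=> // y; rewrite inG => Ky.
by congr (_, _); [apply: cx | apply: addbC].
Qed.

Lemma der_prodG : G^`(1) = setX K^`(1) 1.
Proof.
have := der_dprod 1 (setX_dprod K [set: bool]%G).
have -> : (setX (1 : {set kT}) [set: bool])^`(1) = 1.
  apply/derG1P/centsP=> -[x1 x2] /setXP[/set1P-> _] [y1 y2] /setXP[/set1P-> _].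
  by congr (_, _); apply: addbC.
by rewrite dprodg1 => <-; rewrite -!morphim_pairg1 morphim_der ?subsetT.
Qed.

Lemma coset_repr1 x : x \in G -> (repr (coset Z x)).1 = x.1.
Proof.
move=> Gx; have sZC : Z \subset 'C(G).
  have: Z \subset 'Z(G) by rewrite center_prodG setXS ?sub1G.
  by rewrite subsetI => /andP[].
have Nx : x \in 'N(Z) by apply: (subsetP _ x Gx); rewrite cents_norm // centsC.
have := mem_repr_coset (coset Z x); rewrite val_coset //.
by case/rcosetP=> z; rewrite inZ => /eqP z1 ->; rewrite (fst_morphM z x) z1 mul1g.
Qed.

Lemma prod_deltaE x y : x \in G -> y \in G -> d x y = (1, D x.1 y.1).
Proof. by move=> Gx Gy; rewrite /delta_on /prod_delta !coset_repr1. Qed.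

Let sgnM (s t : bool) : ((1, s) : kT * bool) * (1, t) = (1, s (+) t).
Proof. by congr (_, _); apply: mul1g. Qed.

Let inG' x : (x \in G^`(1)) -> (x.1 \in K^`(1)).
Proof. by case: x => x1 x2; rewrite der_prodG => /setXP[]. Qed.

Let sG'Z : G^`(1) \subset 'Z(G).
Proof. by rewrite der_prodG center_prodG K'Z setXS ?sub1G. Qed.

(** As G has class 2, the fourth axiom reduces to the symmetry
    D([z, y], x) = D([z, x], y). *)
Lemma prod_is_setup : is_setup G prod_delta.
Proof.
split.
- by rewrite center_prodG setXS ?sub1G.
- by move=> u v _ _; rewrite inZ.
- by move=> x Gx; rewrite prod_deltaE // (det_pairing_diag detD) -?inG.
- move=> x y Gx Gy; rewrite !prod_deltaE // (det_pairing_sym detD) -?inG //.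
  by apply/esym/eqP; rewrite eq_invg_mul sgnM addbb.
- move=> x y z Gx Gy Gz G'xyz; rewrite !prod_deltaE ?groupM // sgnM.
  congr (_, _); apply: (det_pairing_mul detD); rewrite -?inG //.
  by case/or3P: G'xyz => /inG' ->; rewrite ?orbT.
move=> x y z Gx Gy Gz; rewrite !prod_deltaE ?groupR //.
rewrite (det_pairing_swap detD) -?inG //; congr (_ * _).
have ->: y * x = x * y * [~ y, x] by rewrite commgEl conjgE !mulgA mulgK mulgV mul1g.
rewrite conjgM; apply/conjg_fixP/commgP/commute_sym.
have /centerP[_ cG] := subsetP sG'Z _ (mem_commg Gy Gx).
by apply: cG; rewrite groupJ ?groupM.
Qed.

Lemma prod_f x y z : x \in G -> y \in G -> z \in G ->
  f prod_delta x y z = (1, D [~ x.1, y.1] z.1).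
Proof. by move=> Gx Gy Gz; rewrite /f prod_deltaE ?groupR. Qed.

Let det1 z : z \in K -> D 1 z = false.
Proof.
move=> Kz; have := det_pairing_mul detD (group1 K) (group1 K) Kz.
by rewrite group1 mulg1 addbb; apply.
Qed.

Let detV k z : k \in K^`(1) -> z \in K -> D k^-1 z = D k z.
Proof.
move=> K'k Kz; have Kk := subsetP (der_sub 1 K) k K'k.
have := det_pairing_mul detD (groupVr Kk) Kk Kz; rewrite K'k orbT mulVg det1 //.
by move=> /(_ isT)/esym/addbP; case: (D k z) (D k^-1 z) => [] [].
Qed.

(** The three terms of g are the same bit, by the symmetry of the determinant. *)
Lemma prod_f_eq_g : {in G & &, forall x y z, f prod_delta x y z = g prod_delta x y z}.
Proof.
move=> x y z Gx Gy Gz; rewrite /g !prod_f // !sgnM.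
rewrite (det_pairing_swap detD (x := z.1)) -?inG // -[[~ z.1, y.1]]invg_comm.
by rewrite detV ?mem_commg -?inG // addbK.
Qed.

Lemma prod_nontrivial : nontrivial_setup G prod_delta.
Proof.
split; first exact: prod_is_setup.
move=> g1; have /negP[] : ~~ (K \subset K^`(1)).
  by apply/negP=> /subset_leq_card; rewrite oK oK'.
apply/subsetP=> z Kz; apply: (det_pairing_radr detD) => // x y Kx Ky.
have := g1 (x, true) (y, true) (z, true).
rewrite -prod_f_eq_g ?inG // prod_f ?inG //= => /(_ Kx Ky Kz).
by case.
Qed.

(** An element t of the radical satisfies D(t, y) = 0 for all y.  With y in K'
    this gives t in K', and then arbitrary y give t = 1. *)
Lemma prod_Rad : Rad G prod_delta = Z.
Proof.
apply/eqP; rewrite eqEsubset; apply/andP; split.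
  apply: subset_trans (gcore_sub _ _) _; apply/subsetP=> t.
  case/setIdP=> Gt tP; rewrite inZ; apply/eqP.
  have Kt : t.1 \in K by rewrite -inG.
  have t0 y : y \in K -> D t.1 y = false.
    move=> Ky; have Gy : (y, 1) \in G by rewrite inG.
    have /forall_inP/(_ _ Gy)/and4P[/eqP + _ _ _] := forall_inP tP 1 (group1 G).
    by rewrite mulg1 !prod_deltaE //= det1 // => -[].
  apply: (det_pairing_radl detD) => //; apply: (det_pairing_radr detD) => // x y Kx Ky.
  by rewrite (det_pairing_sym detD) ?groupR // t0 ?groupR.
have nZG : G \subset 'N(Z).
  have := setup_central prod_is_setup; rewrite subsetI => /andP[_ cZ].
  by rewrite cents_norm // centsC.
apply: gcore_max => //; apply/subsetP=> t; rewrite inZ => /eqP t1.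
have Gt : t \in G by rewrite inG t1.
rewrite inE Gt; apply/forall_inP=> x Gx; apply/forall_inP=> y Gy.
rewrite !prod_deltaE ?groupM //.
have e1 u : (t * u).1 = u.1 by rewrite (fst_morphM t u) t1 mul1g.
have e2 u : (u * t).1 = u.1 by rewrite (fst_morphM u t) t1 mulg1.
by rewrite !e1 !e2 eqxx.
Qed.

(** If D(_, t) is additive, then it does not distinguish xy from yx, so
    D([x, y], t) = 0 and t is in K'. *)
Lemma prod_Mul : Mul G prod_delta = 'Z(G).
Proof.
rewrite center_prodG -K'Z; apply/setP=> -[t s]; rewrite in_setX in_setT andbT.
rewrite inE inG /=; apply/andP/idP=> [[Kt tP] | K't].
  apply: (det_pairing_radr detD) => // x y Kx Ky.
  have Dt u v : u \in K -> v \in K -> D (u * v) t = D u t (+) D v t.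
    move=> Ku Kv; have [Gu Gv] : (u, 1) \in G /\ (v, 1) \in G by rewrite !inG.
    have /forall_inP/(_ _ Gv)/and5P[_ _ _ _ /andP[/eqP + _]] := forall_inP tP _ Gu.
    by rewrite !prod_deltaE ?groupM ?inG // sgnM => -[].
  have := Dt x y Kx Ky; rewrite (commgC x y).
  rewrite (det_pairing_mul detD (groupM Ky Kx) (groupR Kx Ky) Kt);
    last by rewrite mem_commg ?orbT.
  by rewrite Dt // [D y t (+) _]addbC => /(canRL (addKb _)); rewrite addbb.
have Kt := subsetP (der_sub 1 K) t K't.
have Gt : (t, s) \in G by rewrite inG.
split=> //; apply/forall_inP=> x Gx; apply/forall_inP=> y Gy.
have [Kx Ky] : x.1 \in K /\ y.1 \in K by rewrite -!inG.
have DM := det_pairing_mul detD; have DC := det_pairing_sym detD.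
rewrite !prod_deltaE ?groupM // !sgnM /=.
rewrite ![D x.1 (_ * _)]DC ?groupM // ![D t (_ * _)]DC ?groupM //.
rewrite !DM ?K't ?orbT //.
rewrite ![D _ x.1]DC // ![D _ t]DC //.
by rewrite ![D x.1 y.1 (+) _]addbC !eqxx.
Qed.

Lemma prod_Rad_f : Rad_f G prod_delta = 'Z(G).
Proof.
rewrite center_prodG -K'Z; apply/setP=> -[t s]; rewrite in_setX in_setT andbT.
rewrite inE inG /=; apply/andP/idP=> [[Kt tP] | K't].
  apply: (det_pairing_radr detD) => // x y Kx Ky.
  have [Gx Gy] : (x, 1) \in G /\ (y, 1) \in G by rewrite !inG.
  have /forall_inP/(_ _ Gy)/and3P[_ _ /eqP] := forall_inP tP _ Gx.
  by rewrite prod_f ?inG // => -[].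
have Kt := subsetP (der_sub 1 K) t K't.
have Gt : (t, s) \in G by rewrite inG.
split=> //; apply/forall_inP=> x Gx; apply/forall_inP=> y Gy.
have [Kx Ky] : x.1 \in K /\ y.1 \in K by rewrite -!inG.
have tx u : u \in K -> [~ t, u] = 1.
  move=> Ku; apply/eqP/commgP; move: K't; rewrite K'Z.
  by case/centerP=> _; apply.
rewrite !prod_f //= (det_pairing_swap detD _ _ Kt) //.
by rewrite -[[~ x.1, t]]invg_comm tx // invg1 det1 ?eqxx.
Qed.

Lemma prod_isog : K \isog G / Z.
Proof.
apply: isog_trans (isog_setX1 bool K) _; apply: sdprod_isog.
by apply: dprodWsd; rewrite dprodC setX_dprod.
Qed.

Lemma card_prodG : #|G| = 128.
Proof. by rewrite cardsX oK cardsT card_bool. Qed.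

Lemma prod_scenario_i : scenario_i_conditions G prod_delta.
Proof.
have nZG : G \subset 'N(Z).
  have := setup_central prod_is_setup; rewrite subsetI => /andP[_ cZ].
  by rewrite cents_norm // centsC.
have oG' : #|G^`(1)| = 8 by rewrite der_prodG cardsX oK' cards1.
have oZG : #|'Z(G)| = 16 by rewrite center_prodG cardsX -K'Z oK' cardsT card_bool.
have oZGZ : #|'Z(G) / Z| = 8.
  rewrite card_quotient ?(subset_trans (center_sub G)) //.
  rewrite -divgS ?(setup_central prod_is_setup) //.
  by rewrite oZG cardsX cards1 cardsT card_bool.
have oQ' : #|(G / Z)^`(1)| = 8 by rewrite -(card_isog (isog_der 1 prod_isog)).
have oZQ : #|'Z(G / Z)| = 8 by rewrite -(card_isog (isog_center prod_isog)) -[RHS]oK' K'Z.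
split; rewrite ?prod_Rad ?prod_Mul ?prod_Rad_f //.
- apply/eqP; rewrite eqn_leq nil_class2 sG'Z ltnNge nil_class1.
  by apply/negP=> /derG1P G'1; rewrite G'1 cards1 in oG'.
- by rewrite properEcard sG'Z oG' oZG.
- apply/esym/eqP; rewrite eqEcard oZQ oZGZ leqnn andbT.
  by rewrite subsetI quotientS ?center_sub // quotient_cents // subsetIr.
- apply/esym/eqP; rewrite eqEcard oQ' oZGZ leqnn andbT.
  by rewrite -quotient_der ?quotientS.
exact: prod_f_eq_g.
Qed.

End ProductSetup.

(** * A group with K' = Z(K) of order 8 and index 8 *)

(** A bilinear cocycle with antisymmetrization cross; see half_cross_skew. *)
Definition half_cross (v w : bool3) : bool3 :=
  let: (v1, v2, v3) := v in let: (w1, w2, w3) := w in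
  (v2 && w3, v3 && w1, v1 && w2).

Lemma half_crossMl u : {morph half_cross^~ u : v w / v * w}.
Proof. by move: u => [[[] []] []] [[[] []] []] [[[] []] []]. Qed.

Lemma half_crossMr u : {morph half_cross u : v w / v * w}.
Proof. by move: u => [[[] []] []] [[[] []] []] [[[] []] []]. Qed.

Lemma half_cross_skew v w : half_cross v w = half_cross w v * cross v w.
Proof. by move: v w => [[[] []] []] [[[] []] []]. Qed.

Lemma bool3_mulC : @commutative bool3 bool3 *%g.
Proof. by move=> [[[] []] []] [[[] []] []]. Qed.

Lemma bool3_sqr (v : bool3) : v * v = 1.
Proof. by move: v => [[[] []] []]. Qed.

(** The carrier of the central extension of V by its exterior square that has the
    cocycle half_cross; the product type carries the split extension. *)
Definition twisted := (bool3 * bool3)%type.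
HB.instance Definition _ := Finite.on twisted.

Definition twisted_mul (x y : twisted) : twisted :=
  (x.1 * y.1, x.2 * y.2 * half_cross x.1 y.1).
Definition twisted_one : twisted := (1, 1).
Definition twisted_inv (x : twisted) : twisted := (x.1, x.2 * half_cross x.1 x.1).

Lemma twisted_mulA : associative twisted_mul.
Proof.
move=> [v p] [w q] [u r].
have eq2 : p * (q * r * half_cross w u) * half_cross v (w * u)
         = p * q * half_cross v w * r * half_cross (v * w) u.
  rewrite half_crossMl half_crossMr -!mulgA; congr (_ * (_ * _)).
  by rewrite [RHS]bool3_mulC -!mulgA; congr (_ * _); rewrite [RHS]bool3_mulC -mulgA.
by congr (_, _); [apply: mulgA | apply: eq2].
Qed.

Lemma twisted_mul1 : left_id twisted_one twisted_mul.
Proof. by move=> [v [[[] []] []]]; move: v => [[[] []] []]. Qed.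

Lemma twisted_mulV : left_inverse twisted_one twisted_inv twisted_mul.
Proof.
move=> [v p].
have eq2 : p * half_cross v v * p * half_cross v v = 1.
  by rewrite -[LHS]mulgA bool3_sqr.
by congr (_, _); [apply: bool3_sqr | apply: eq2].
Qed.

HB.instance Definition _ :=
  Finite_isGroup.Build twisted twisted_mulA twisted_mul1 twisted_mulV.

Lemma twisted_comm (x y : twisted) : [~ x, y] = (1, cross x.1 y.1).
Proof.
apply: (mulgI (y * x)); rewrite -commgC; move: x y => [v p] [w q].
have eq2 : p * q * half_cross v w =
    q * p * half_cross w v * cross v w * half_cross (w * v) 1.
  have ->: half_cross (w * v) 1 = 1 by move: (w * v) => [[[] []] []].
  by rewrite mulg1 half_cross_skew [p * q]bool3_mulC mulgA.
by congr (_, _); [rewrite [LHS]bool3_mulC; apply/esym/mulg1 | apply: eq2].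
Qed.

Lemma twisted_center : 'Z([set: twisted]) = [set x : twisted | x.1 == 1].
Proof.
apply/setP=> x; rewrite [RHS]inE; apply/centerP/eqP => [[_ cx] | x1].
  have x0 w : cross x.1 w = 1.
    have /commgP/eqP := cx (w, 1) (in_setT _).
    by rewrite twisted_comm => /(congr1 snd).
  have := (x0 (true, false, false), x0 (false, true, false)).
  by case: (x.1) => [[[] []] []] [].
split=> [|y _]; first exact: in_setT.
apply/commgP/eqP; rewrite twisted_comm x1; congr (_, _).
by case: (y.1) => [[[] []] []].
Qed.

Lemma twisted_der : [set: twisted]^`(1) = 'Z([set: twisted]).
Proof.
apply/eqP; rewrite eqEsubset gen_subG; apply/andP; split.
  by apply/subsetP=> _ /imset2P[x y _ _ ->]; rewrite /= twisted_center inE twisted_comm.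
rewrite twisted_center; apply/subsetP=> -[v p]; rewrite inE => /eqP/= ->.
have [u1 [u2 ->]] := cross_surj p.
have <- := twisted_comm (u1, 1) (u2, 1); by apply: mem_commg; apply: in_setT.
Qed.

Lemma twisted_spec :
  [/\ #|[set: twisted]| = 64, #|[set: twisted]^`(1)| = 8
    & [set: twisted]^`(1) = 'Z([set: twisted])].
Proof.
split; last exact: twisted_der; first by rewrite cardsT !card_prod card_bool.
rewrite twisted_der twisted_center.
have -> : [set x : twisted | x.1 == 1] = [set ((1, p) : twisted) | p in [set: bool3]].
  apply/setP=> -[v p]; rewrite inE; apply/eqP/imsetP => [/= -> | [q _ [-> _]]] //.
  by exists p; rewrite ?inE.
by rewrite card_imset ?cardsT ?card_prod ?card_bool // => p q [].
Qed.

(** * The characterization *)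

Lemma exists_scenario_i (kT : finGroupType) (K : {group kT}) :
  [/\ #|K| = 64, #|K^`(1)| = 8 & K^`(1) = 'Z(K)] ->
  exists (gT : finGroupType) (G Z : {group gT}) (delta : coset_of Z -> coset_of Z -> gT),
    [/\ scenario_i G delta, K \isog G / Z & #|G| = 128].
Proof.
case=> oK oK' K'Z; have [D detD] := exists_det_pairing oK oK' K'Z.
exists (kT * bool)%type, (prodG K), (prodZ kT), (prod_delta D).
split; [split; [split|] | |].
- exact: prod_nontrivial detD.
- by move=> hT H W eps /nontrivial_setup_order[H128 _]; rewrite card_prodG.
- exact: prod_scenario_i detD.
- exact: prod_isog.
exact: card_prodG.
Qed.

Theorem proposition7p4 (kT : finGroupType) (K : {group kT}) :
  ((exists (gT : finGroupType) (G Z : {group gT})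
      (delta : coset_of Z -> coset_of Z -> gT),
      minimal_setup G delta /\ K \isog G / Z) <->
   [/\ #|K| = 64, #|K^`(1)| = 8 & K^`(1) = 'Z(K)]) /\
  ([/\ #|K| = 64, #|K^`(1)| = 8 & K^`(1) = 'Z(K)] ->
   exists (gT : finGroupType) (G Z : {group gT})
      (delta : coset_of Z -> coset_of Z -> gT),
      scenario_i G delta /\ K \isog G / Z).
Proof.
have realize := @exists_scenario_i kT K.
split; last by move=> /realize[gT [G [Z [delta [sc iso _]]]]]; exists gT, G, Z, delta.
split; last first.
  move=> /realize[gT [G [Z [delta [[minG _] iso _]]]]].
  by exists gT, G, Z, delta.
case=> gT [G [Z [delta [[ntG minG] isoK]]]].
(* The order of a minimal setup is bounded by that of the setup of an example. *)
have [hT [H [W [eps [[[ntH _] _] _ oH]]]]] := exists_scenario_i twisted_spec.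
have leG : #|G| <= 128 by rewrite -oH; apply: minG ntH.
have [_ /(_ leG)[oQ oQ' Q'Z]] := nontrivial_setup_order ntG.
have oK' : #|K^`(1)| = 8 by rewrite (card_isog (isog_der 1 isoK)).
split=> //; first by rewrite (card_isog isoK).
have [f injf fK] := isogP isoK.
apply: (injm_morphim_inj injf); rewrite ?der_sub ?center_sub //.
by rewrite morphim_der // injm_center //= fK.
Qed.
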